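(* If $G$ is a subdivision of a simple $3$-connected plane graph $R$ with $\Delta^*(G) \geq 2\chi_c(R) + 2t(G) - 6$, then $\chi_c(G) \leq \lfloor \frac{3}{2}\Delta^*(G)\rfloor$.
   Context: Plane graphs may have multiple edges but no loops; a simple graph has no multiple edges. The degree of a face is the number of vertices incident with it; $\Delta^*(G)$ is the maximum face degree. A subdivision of a graph is obtained by repeatedly replacing an edge $uv$ by a path $u,w,v$ through a new vertex $w$. $t(G)$ denotes the number of vertices of a longest path in $G$ all of whose vertices have degree $2$ (and $t(G)=0$ if there is no vertex of degree 2). A cyclic coloring of a plane graph is a vertex coloring in which any two distinct vertices incident with a common face receive distinct colors; $\chi_c$ denotes the minimum number of colors in a cyclic coloring. *)

(* Defs.v *)
From mathcomp Require Import all_boot.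

Set Implicit Arguments.
Unset Strict Implicit.
Unset Printing Implicit Defensive.

(* A finite loopless multigraph. Each edge is a pair {d, drev d} of opposite
   darts; the dart d runs from src d to src (drev d). *)
Record multigraph := Multigraph {
  vert : finType;
  dart : finType;
  src : dart -> vert;
  drev : dart -> dart;
  drevK : involutive drev;
  no_loop : forall d, src (drev d) != src d
}.

Definition adj (G : multigraph) : rel (vert G) :=
  fun u v => [exists d : dart G, (src d == u) && (src (drev d) == v)].

Definition degree (G : multigraph) (v : vert G) : nat :=
  #|[set d : dart G | src d == v]|.

Definition simple_graph (G : multigraph) : Prop :=
  forall d d' : dart G,
    src d = src d' -> src (drev d) = src (drev d') -> d = d'.

Definition k_connected (k : nat) (G : multigraph) : Prop :=
  k < #|vert G| /\
  forall S : {set vert G}, #|S| < k ->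
  forall u v : vert G, u \notin S -> v \notin S ->
    connect [rel x y | adj x y && (y \notin S)] u v.

(* The value is 0 when there is no vertex of degree 2, as the empty tuple
   qualifies for n = 0. *)
Definition t_num (G : multigraph) : nat :=
  \max_(n < #|vert G|.+1 |
        [exists s : n.-tuple (vert G),
          [&& uniq s, sorted (@adj G) s & all (fun v => degree v == 2) s]]) n.

(* A connected plane graph with at least one edge, given as a combinatorial map:
   drot is the cyclic order of the darts around each vertex, the faces are the
   orbits of drot \o drev, and the embedding is in the plane by Euler's formula
   #V + #F = #E + 2. The formula and connectedness together exclude graphs
   without edges, so every vertex is the source of some dart. *)
Record plane_graph := PlaneGraph {
  graph_of :> multigraph;
  drot : dart graph_of -> dart graph_of;
  drot_inj : injective drot;
  drot_orbit : forall d d', fconnect drot d d' = (src d == src d');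
  plane_connected : forall u v : vert graph_of, connect (@adj graph_of) u v;
  euler_formula :
    #|vert graph_of| + fcard (fun d => drot (drev d)) (dart graph_of)
      = #|dart graph_of|./2 + 2
}.

Definition face_next (G : plane_graph) (d : dart G) : dart G := drot (drev d).

(* The vertices incident with the face whose boundary contains the dart d. As d
   ranges over all darts, this ranges over all faces. *)
Definition face_verts (G : plane_graph) (d : dart G) : {set vert G} :=
  [set src d' | d' in fconnect (@face_next G) d].

(* Vertices are counted without repetition along the boundary walk. *)
Definition face_degree (G : plane_graph) (d : dart G) : nat := #|face_verts d|.

Definition max_face_degree (G : plane_graph) : nat :=
  \max_(d : dart G) face_degree d.

Definition cyclic_coloring (G : plane_graph) (k : nat)
    (c : {ffun vert G -> 'I_k}) : bool :=
  [forall d : dart G, forall u in face_verts d, forall v in face_verts d,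
     (u != v) ==> (c u != c v)].

Definition cyclic_colorable (G : plane_graph) (k : nat) : bool :=
  [exists c : {ffun vert G -> 'I_k}, cyclic_coloring c].

Lemma ex_cyclic_colorable (G : plane_graph) : exists k, cyclic_colorable G k.
Proof.
exists #|vert G|; apply/existsP; exists [ffun v => enum_rank v].
apply/forallP=> d; apply/forall_inP=> u _; apply/forall_inP=> v _.
by apply/implyP; apply: contra; rewrite !ffunE => /eqP /enum_rank_inj ->.
Qed.

Definition chi_c (G : plane_graph) : nat := ex_minn (ex_cyclic_colorable G).

(* H arises from G, up to renaming by fV and fD, by putting a new vertex
   w = fV None on the edge {e, drev e}. The darts e and drev e keep their sources
   and their places in the rotation and now end at w; the two new darts
   fD (inr false) and fD (inr true) at w are their respective reverses. *)
Definition subdivides_edge (G H : plane_graph) : Prop :=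
  exists (e : dart G) (fV : option (vert G) -> vert H)
         (fD : dart G + bool -> dart H),
  [/\ bijective fV, bijective fD,
      (forall d, src (fD (inl d)) = fV (Some (src d))) /\
      (forall b, src (fD (inr b)) = fV None),
      forall d, drev (fD (inl d)) =
        if d == e then fD (inr false)
        else if d == drev e then fD (inr true)
        else fD (inl (drev d))
    & (forall d, drot (fD (inl d)) = fD (inl (drot d))) /\
      (forall b, drot (fD (inr b)) = fD (inr (~~ b)))].

Inductive subdivision (R : plane_graph) : plane_graph -> Prop :=
| subdivision_refl : subdivision R R
| subdivision_step G H :
    subdivision R G -> subdivides_edge G H -> subdivision R H.

(* Main.v *)
Require Import Defs.
From mathcomp Require Import all_boot fingroup perm zify.

Set Implicit Arguments.
Unset Strict Implicit.
Unset Printing Implicit Defensive.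

(* Color the vertices of [R] in [G] with [chi_c R] colors. The remaining
   vertices have degree 2, and each lies on exactly two faces; view it as an
   edge joining these two faces. Since [R] is 3-connected, two faces share at
   most one edge of [R], so the resulting multigraph has multiplicity at most
   [t_num G], and as every face has at least 3 vertices of [R], its maximum
   degree is at most [max_face_degree G - 3]. Vizing's theorem for multigraphs
   colors it with [max_face_degree G - 3 + t_num G] further colors.

   That two faces share at most one edge is read off Euler's formula: deleting
   two edges with the same pair of faces leaves the number of faces unchanged,
   hence disconnects the graph by the genus inequality, whereas a 3-connected
   graph is 3-edge-connected. *)

Local Notation tgt d := (src (drev d)).

Lemma connect_stable (T : finType) (e : rel T) (P : {pred T}) :
    (forall x y, e x y -> x \in P -> y \in P) ->
  forall x y, connect e x y -> x \in P -> y \in P.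
Proof.
move=> eP x y /connectP[p + ->]; elim: p x => //= z p IHp x /andP[xz /IHp zP].
by move/(eP x z xz).
Qed.

(** * Vizing's theorem for multigraphs *)

Section TwoInvolutions.

Variables (T : finType) (f g : T -> T) (x : T).
Hypotheses (fK : involutive f) (gK : involutive g) (gx : g x = x).

Let fg_inj : injective (f \o g) := inj_comp (inv_inj fK) (inv_inj gK).

Let iter_comp_reverse i : iter i (f \o g) (g (iter i (f \o g) x)) = x.
Proof. by elim: i => [//|i IHi]; rewrite iterSr iterS /= gK fK. Qed.

Lemma fconnect_comp_invr y :
  fconnect (f \o g) x y -> fconnect (f \o g) x (g y).
Proof.
move=> /iter_findex <-; rewrite (fconnect_sym fg_inj).
rewrite -[X in fconnect _ _ X](iter_comp_reverse (findex (f \o g) x y)).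
exact: fconnect_iter.
Qed.

Lemma fconnect_comp_invl y :
  fconnect (f \o g) x y -> fconnect (f \o g) x (f y).
Proof.
move/fconnect_comp_invr=> xgy; apply: connect_trans xgy _.
by rewrite -{2}(gK y) -[f _]/((f \o g) (g y)) fconnect1.
Qed.

Lemma fconnect_comp_fix_uniq y z :
    fconnect (f \o g) x y -> fconnect (f \o g) x z -> f y = y -> f z = z ->
  y = z.
Proof.
set h := f \o g.
have iter_double i : f (iter i h x) = iter i h x -> iter (i + i) h x = h x.
  move=> fix_i; rewrite iterD -{}fix_i -{1}(gK (iter i h x)) -[f _]/(h (g _)).
  by rewrite -iterSr iterS iter_comp_reverse.
have iter_double_mul i j : f (iter i h x) = iter i h x ->
    iter ((i + i) * j) h x = iter j h x.
  move/iter_double=> period; elim: j => [|j IHj]; first by rewrite muln0.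
  by rewrite mulnS addnC iterD period -iterSr iterS IHj.
move=> /iter_findex <- /iter_findex <-.
set i := findex h x y; set j := findex h x z.
move=> /iter_double_mul fix_i /iter_double_mul fix_j.
by rewrite -(fix_j i) -(fix_i j); congr (iter _ h x); lia.
Qed.

End TwoInvolutions.

Lemma drev_inj (G : multigraph) : injective (@drev G).
Proof. exact: inv_inj (@drevK G). Qed.

Lemma drev_neq (G : multigraph) (d : dart G) : drev d != d.
Proof. by apply: contraNneq (no_loop d) => ->. Qed.

Lemma drev_eq (G : multigraph) (d d' : dart G) :
  (drev d == d') = (d == drev d').
Proof. exact: can2_eq (@drevK G) (@drevK G) d d'. Qed.

Section PartialEdgeColorings.

Variables (G : multigraph) (K : finType).
Implicit Types (c : {ffun dart G -> option K}) (d e : dart G) (v x : vert G).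
Implicit Types (k : K) (o : option K).

Definition partial_coloring c :=
  [forall d, c (drev d) == c d] &&
  [forall d, forall d', [&& src d == src d', c d == c d' & c d] ==> (d == d')].

Lemma partial_coloringP c : reflect
  ((forall d, c (drev d) = c d) /\
   forall d d' k, src d = src d' -> c d = Some k -> c d' = Some k -> d = d')
  (partial_coloring c).
Proof.
apply: (iffP andP) => [[/'forall_eqP cV /forallP c_inj]|[cV c_inj]].
  split=> // d d' k /eqP dd' cd cd'; have /forallP/(_ d') := c_inj d.
  by rewrite dd' cd cd' eqxx => /eqP.
split; first exact/'forall_eqP.
apply/forallP=> d; apply/forallP=> d'; apply/implyP=> /and3P[/eqP dd' /eqP].
by case cd: (c d) => [k|//] cd' _; apply/eqP/(c_inj d d' k).
Qed.

Definition missing c v k := [forall d, (src d == v) ==> (c d != Some k)].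

Lemma missingP c v k :
  reflect (forall d, src d = v -> c d <> Some k) (missing c v k).
Proof.
apply: (iffP forallP) => miss d => [/eqP dv|].
  by have := miss d; rewrite dv => /eqP.
by apply/implyP=> /eqP /miss /eqP.
Qed.

Lemma missingPn c v k :
  reflect (exists2 d, src d = v & c d = Some k) (~~ missing c v k).
Proof.
apply: (iffP forallPn) => -[d].
  by rewrite negb_imply negbK => /andP[/eqP dv /eqP cd]; exists d.
by move=> /eqP dv /eqP cd; exists d; rewrite dv cd.
Qed.

Definition recolor c d o : {ffun dart G -> option K} :=
  [ffun e => if e \in [set d; drev d] then o else c e].

Lemma recolor_id c d o : recolor c d o d = o.
Proof. by rewrite ffunE set21. Qed.

Lemma recolor_src c d o e : src e = src d -> e != d -> recolor c d o e = c e.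
Proof.
move=> ed ne; rewrite ffunE !inE (negPf ne).
by case: eqP => // eE; have := no_loop d; rewrite -eE ed eqxx.
Qed.

Lemma missing_recolor c d o v k :
  o <> Some k -> missing c v k -> missing (recolor c d o) v k.
Proof.
by move=> ok /missingP miss; apply/missingP=> e ev; rewrite ffunE;
  case: ifP => // _; apply: miss.
Qed.

Lemma partial_coloring_recolor c d o :
    (forall k, o = Some k -> missing c (src d) k /\ missing c (tgt d) k) ->
  partial_coloring c -> partial_coloring (recolor c d o).
Proof.
move=> miss /partial_coloringP[cV c_inj]; apply/partial_coloringP; split=> [e|].
  by rewrite !ffunE !inE drev_eq (inj_eq (@drev_inj G)) orbC cV.
have no_clash e e' k : src e = src e' -> e \in [set d; drev d] -> o = Some k ->
    c e' <> Some k.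
  move=> ee' + /miss[/missingP miss_src /missingP miss_tgt].
  by rewrite !inE => /orP[] /eqP eE; [apply: miss_src | apply: miss_tgt];
    rewrite -ee' eE.
move=> e e' k ee'; rewrite !ffunE.
case: ifP => eE; case: ifP => e'E; last exact: c_inj.
- move: eE e'E ee'; rewrite !inE => /orP[] /eqP -> /orP[] /eqP -> // ee';
    by have := no_loop d; rewrite ee' eqxx.
- by move=> oE /(no_clash _ _ _ ee' eE oE).
- by move=> + oE => /(no_clash _ _ _ (esym ee') e'E oE).
Qed.

Definition colored c := [set d | c d].

Lemma card_colored_add c d k : partial_coloring c -> c d = None ->
  #|colored (recolor c d (Some k))| = #|colored c| + 2.
Proof.
case/partial_coloringP=> cV _ cd.
have -> : colored (recolor c d (Some k)) = d |: (drev d |: colored c).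
  by apply/setP=> e; rewrite !inE ffunE !inE orbA; case: ifP.
by rewrite !cardsU1 !inE eq_sym (negPf (drev_neq d)) cV cd addnA addnC.
Qed.

Lemma card_colored_erase c d k : partial_coloring c -> c d = Some k ->
  #|colored c| = #|colored (recolor c d None)| + 2.
Proof.
move=> c_ok cd; have [cV _] := partial_coloringP c c_ok.
rewrite -(@card_colored_add _ d k) ?recolor_id ?partial_coloring_recolor //.
apply: eq_card => e; rewrite !inE !ffunE !inE.
by case: orP => // -[] /eqP ->; rewrite ?cV cd.
Qed.

Definition maximal_coloring c :=
  partial_coloring c /\
  forall c', partial_coloring c' -> #|colored c'| <= #|colored c|.

Lemma maximal_coloring_missing c d k :
    maximal_coloring c -> c d = None -> missing c (src d) k ->
  ~~ missing c (tgt d) k.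
Proof.
move=> [c_ok c_max] cd miss_src; apply/negP=> miss_tgt.
have := c_max (recolor c d (Some k)); rewrite card_colored_add // => leq_max.
suff /leq_max : partial_coloring (recolor c d (Some k)) by lia.
by apply: partial_coloring_recolor c_ok => k' [<-].
Qed.

Definition fan_step c x : rel (dart G) := fun d d' =>
  (src d' == x) && oapp (missing c (tgt d)) false (c d').

Lemma fan_stepP c x d d' :
  reflect (exists k, [/\ src d' = x, c d' = Some k & missing c (tgt d) k])
          (fan_step c x d d').
Proof.
apply: (iffP andP) => [[/eqP d'x]|[k [-> -> miss]]]; last by rewrite eqxx.
by case: (c d') => [k|//]; exists k.
Qed.

Definition fan c d := [set d' | connect (fan_step c (src d)) d d'].

Lemma fan_id c d : d \in fan c d.
Proof. by rewrite inE. Qed.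

Lemma fan_step_fan c d e e' :
  e \in fan c d -> fan_step c (src d) e e' -> e' \in fan c d.
Proof. by rewrite !inE => de ee'; apply: connect_trans de (connect1 ee'). Qed.

Lemma fan_src c d e : e \in fan c d -> src e = src d.
Proof.
rewrite inE => de; suff : e \in [pred e' | src e' == src d] by move/eqP.
by apply: (connect_stable _ de) => [y z /fan_stepP[k [/eqP]]|] //; apply/eqP.
Qed.

Section Shift.

Variables (c : {ffun dart G -> option K}) (d d' : dart G) (k : K).
Hypotheses (c_ok : partial_coloring c) (cd : c d = None).
Hypotheses (dd' : src d' = src d) (cd' : c d' = Some k).
Hypothesis miss_k : missing c (tgt d) k.

Definition shift := recolor (recolor c d' None) d (Some k).

Let neq_dd' : d != d'.
Proof. by apply: contra_eq_neq cd => ->; rewrite cd'. Qed.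

Lemma partial_coloring_shift : partial_coloring shift.
Proof.
have [_ c_inj] := partial_coloringP c c_ok.
apply: partial_coloring_recolor => [_ [<-]|].
  split; last exact: missing_recolor.
  apply/missingP=> e ed ce; have e_neq : e != d'.
    by apply: contra_eq_neq ce => ->; rewrite recolor_id.
  move: ce; rewrite recolor_src ?dd' // => ce.
  by move: e_neq; rewrite (c_inj e d' k) ?eqxx ?dd'.
exact: partial_coloring_recolor c_ok.
Qed.

Lemma card_colored_shift : #|colored shift| = #|colored c|.
Proof.
rewrite card_colored_add ?(card_colored_erase c_ok cd') //.
  exact: partial_coloring_recolor c_ok.
by rewrite recolor_src.
Qed.

Lemma shift_id : shift d' = None.
Proof. by rewrite recolor_src ?recolor_id // eq_sym. Qed.

Lemma shift_src e : src e = src d -> e != d -> e != d' -> shift e = c e.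
Proof. by move=> ed ned ned'; rewrite !recolor_src ?dd'. Qed.

Lemma missing_shift v k' : k' <> k -> missing c v k' -> missing shift v k'.
Proof.
move=> nk miss; apply: missing_recolor; last exact: missing_recolor.
by case=> /esym.
Qed.

Lemma fan_step_shift e e' :
    e' != d -> e' != d' -> fan_step c (src d) e e' ->
  fan_step shift (src d) e e'.
Proof.
move=> ne'd ne'd' /fan_stepP[k' [e'd ce' miss]].
apply/fan_stepP; exists k'; rewrite shift_src //; split=> //.
apply: missing_shift => // k'E; case/eqP: ne'd'; rewrite {}k'E in ce'.
have [_ c_inj] := partial_coloringP c c_ok.
by apply: c_inj ce' cd'; rewrite e'd dd'.
Qed.

End Shift.

Lemma maximal_coloring_shift c d d' k :
    maximal_coloring c -> c d = None -> src d' = src d -> c d' = Some k ->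
  missing c (tgt d) k -> maximal_coloring (shift c d d' k).
Proof.
case=> c_ok c_max cd dd' cd' miss; split; first exact: partial_coloring_shift.
by rewrite card_colored_shift.
Qed.

Lemma fan_path_missing c d p k :
    maximal_coloring c -> c d = None -> uniq (d :: p) ->
    path (fan_step c (src d)) d p -> missing c (src d) k ->
  ~~ missing c (tgt (last d p)) k.
Proof.
elim: p c d => [|d' p IHp] c d c_max cd.
  by move=> _ _; apply: maximal_coloring_missing.
rewrite cons_uniq [path _ _ _]/= [last _ _]/= => /andP[d_notin p_uniq].
case/andP=> /fan_stepP[k' [dd' cd' miss']] fan_p miss.
have [c_ok _] := c_max.
have nk : k <> k' by move=> kE; have /missingP/(_ d' dd') := miss; rewrite kE.
apply: contra (@missing_shift c d d' k' _ _ nk) _; apply: IHp => //.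
- exact: maximal_coloring_shift miss'.
- exact: shift_id cd dd' cd'.
- rewrite dd'; apply/(pathP d) => i lt_ip; have /(pathP d)/(_ i lt_ip) := fan_p.
  have p_i := mem_nth d lt_ip; apply: fan_step_shift => //.
    by apply: contraNneq d_notin => <-; rewrite inE p_i orbT.
  by case/andP: p_uniq => d'_notin _; apply: contraNneq d'_notin => <-.
- by rewrite dd'; apply: missing_shift.
Qed.

Lemma fan_missing c d d' k :
    maximal_coloring c -> c d = None -> d' \in fan c d ->
  missing c (src d) k -> ~~ missing c (tgt d') k.
Proof.
move=> c_max cd; rewrite inE => /connectP[p fan_p ->].
by case/shortenP: fan_p => p' fan_p' p'_uniq _; apply: fan_path_missing.
Qed.

Definition kempe_closed c k1 k2 (C : {set vert G}) :=
  forall d, c d = Some k1 \/ c d = Some k2 -> (src d \in C) = (tgt d \in C).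

Section KempeSwap.

Variables (c : {ffun dart G -> option K}) (k1 k2 : K) (C : {set vert G}).
Hypothesis C_closed : kempe_closed c k1 k2 C.

Definition kempe_swap : {ffun dart G -> option K} :=
  [ffun d => if src d \in C then c d else omap (tperm k1 k2) (c d)].

Lemma missing_kempe_swap v k :
  missing kempe_swap v k = missing c v (if v \in C then k else tperm k1 k2 k).
Proof.
apply: eq_forallb => d; case: eqP => //= dv; rewrite ffunE dv.
case: ifP => // _; case: (c d) => [k'|] //=; congr (~~ _).
by rewrite !(inj_eq (@Some_inj _)) -(inj_eq (@perm_inj _ (tperm k1 k2))) tpermK.
Qed.

Lemma partial_coloring_kempe_swap :
  partial_coloring c -> partial_coloring kempe_swap.
Proof.
move=> /partial_coloringP[cV c_inj]; apply/partial_coloringP; split=> [d|].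
  rewrite !ffunE cV; case cd: (c d) => [k|]; last by rewrite !if_same.
  have [kE|n1] := eqVneq k k1; first by rewrite (@C_closed d) ?cd ?kE; [|left].
  have [kE|n2] := eqVneq k k2; first by rewrite (@C_closed d) ?cd ?kE; [|right].
  by rewrite /= tpermD 1?eq_sym // !if_same.
move=> d d' k dd'; rewrite !ffunE -dd'; case: ifP => _; first exact: c_inj.
case cd: (c d) => [i|] //= [<-]; case cd': (c d') => [i'|] //= [/perm_inj i'E].
by apply: c_inj cd _ => //; rewrite cd' i'E.
Qed.

Lemma maximal_coloring_kempe_swap :
  maximal_coloring c -> maximal_coloring kempe_swap.
Proof.
case=> c_ok c_max; split; first exact: partial_coloring_kempe_swap.
suff -> : #|colored kempe_swap| = #|colored c| by [].
by apply: eq_card => d; rewrite !inE ffunE; case: ifP => // _; case: (c d).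
Qed.

End KempeSwap.

Definition mate c k v :=
  if [pick d | (src d == v) && (c d == Some k)] is Some d then tgt d else v.

Lemma mate_src c k d : partial_coloring c -> c d = Some k ->
  mate c k (src d) = tgt d.
Proof.
case/partial_coloringP=> _ c_inj cd; rewrite /mate.
case: pickP => [d' /andP[/eqP d'd /eqP cd']|/(_ d)].
  by rewrite (c_inj d' d k).
by rewrite eqxx cd eqxx.
Qed.

Lemma mate_missing c k v : missing c v k -> mate c k v = v.
Proof.
move/missingP=> miss; rewrite /mate.
by case: pickP => // d /andP[/eqP/miss + /eqP].
Qed.

Lemma mateK c k : partial_coloring c -> involutive (mate c k).
Proof.
move=> c_ok v; have [cV _] := partial_coloringP c c_ok.
have [miss|/missingPn[d <- cd]] := boolP (missing c v k).
  by rewrite !mate_missing.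
by rewrite mate_src // mate_src ?cV // drevK.
Qed.

Lemma kempe_component c x y z k1 k2 :
    partial_coloring c ->
    missing c x k2 -> missing c y k1 -> missing c z k1 -> y != z ->
  exists C : {set vert G},
    [/\ x \in C, ~~ ((y \in C) && (z \in C)) & kempe_closed c k1 k2 C].
Proof.
move=> c_ok miss_x miss_y miss_z nyz.
have fix_x := mate_missing miss_x.
have K1 := mateK k1 c_ok; have K2 := mateK k2 c_ok.
have [cV _] := partial_coloringP c c_ok.
pose C := [set v | fconnect (mate c k1 \o mate c k2) x v].
have C_closed d : c d = Some k1 \/ c d = Some k2 ->
    src d \in C -> tgt d \in C.
  by rewrite !inE => -[] cd; rewrite -(mate_src c_ok cd);
    [apply: fconnect_comp_invl | apply: fconnect_comp_invr].
exists C; split=> [||d cd]; first by rewrite inE connect0.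
  apply: contra nyz; rewrite !inE => /andP[xy xz]; apply/eqP.
  by apply: fconnect_comp_fix_uniq xy xz _ _; rewrite ?mate_missing.
apply/idP/idP; first exact: C_closed.
by rewrite -{2}(drevK d); apply: C_closed; rewrite cV.
Qed.

Lemma fan_first_missing c d d' k :
    d' \in fan c d -> missing c (tgt d') k ->
  exists2 e, missing c (tgt e) k &
    connect [rel y z | fan_step c (src d) y z && (c z != Some k)] d e.
Proof.
rewrite inE => /connectP[p]; move: (src d) => x.
elim: p d => [|w p IHp] d /=; first by move=> _ -> miss; exists d.
case/andP=> dw fan_p d'E miss.
have [miss_d|nmiss_d] := boolP (missing c (tgt d) k); first by exists d.
have [e miss_e we] := IHp w fan_p d'E miss; exists e => //.
apply: connect_trans (connect1 _) we; rewrite /= dw.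
have /fan_stepP[k' [_ -> miss']] := dw.
by apply: contraNneq nmiss_d => -[<-].
Qed.

Section KempeFan.

Variables (c : {ffun dart G -> option K}) (k k2 : K) (C : {set vert G}).
Variable d0 : dart G.
Hypotheses (d0C : src d0 \in C) (miss_d0 : missing c (src d0) k2).

Let c' := kempe_swap c k k2 C.
Let x := src d0.

Lemma kempe_swap_src d : src d = x -> c' d = c d.
Proof. by move=> dx; rewrite ffunE dx d0C. Qed.

Lemma fan_step_kempe_swap d d' :
  fan_step c x d d' -> c d' != Some k -> fan_step c' x d d'.
Proof.
case/fan_stepP=> k' [d'x cd' miss] nk; apply/fan_stepP; exists k'.
rewrite kempe_swap_src // missing_kempe_swap; split=> //; case: ifP => // _.
rewrite tpermD //; first by apply: contraNneq nk => ->; rewrite cd'.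
by apply/eqP=> kE; have /missingP/(_ d' d'x) := miss_d0; rewrite cd' kE.
Qed.

(* A step of the old fan to a dart colored [k] can be taken from [e] instead. *)
Lemma fan_kempe_swap e :
    e \in fan c' d0 -> missing c' (tgt e) k -> fan c d0 \subset fan c' d0.
Proof.
move=> fan_e miss_e; apply/subsetP=> d; rewrite inE => d0d.
apply: (connect_stable _ d0d) => [y z yz fan_y|]; last exact: fan_id.
have [cz|nz] := eqVneq (c z) (Some k); last first.
  exact: fan_step_fan fan_y (fan_step_kempe_swap yz nz).
apply: fan_step_fan fan_e _; have /fan_stepP[_ [zx _ _]] := yz.
by apply/fan_stepP; exists k; rewrite kempe_swap_src.
Qed.

End KempeFan.

(* Otherwise a Kempe swap away from the component of [src d0] keeps the fan and
   makes [k2] missing at one of its ends, without affecting [src d0]. *)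
Lemma fan_missing_inj c d0 d d' k k2 :
    maximal_coloring c -> c d0 = None -> missing c (src d0) k2 ->
    d \in fan c d0 -> d' \in fan c d0 ->
    missing c (tgt d) k -> missing c (tgt d') k ->
  tgt d = tgt d'.
Proof.
move=> c_max cd0 miss_d0 fan_d fan_d' miss_d miss_d'.
have [//|neq_tgt] := eqVneq (tgt d) (tgt d').
have [e1 miss_e1 d0e1] := fan_first_missing fan_d miss_d.
have [e2 fan_e2 [miss_e2 neq12]] : exists2 e2,
    e2 \in fan c d0 & missing c (tgt e2) k /\ tgt e1 != tgt e2.
  by have [->|] := eqVneq (tgt e1) (tgt d); [exists d' | exists d].
have [C [d0C C12 C_closed]] :=
  kempe_component c_max.1 miss_d0 miss_e1 miss_e2 neq12.
pose c' := kempe_swap c k k2 C.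
have c'_max : maximal_coloring c' by apply: maximal_coloring_kempe_swap.
have c'd0 : c' d0 = None by rewrite (@kempe_swap_src c k k2 C d0).
have miss'_d0 : missing c' (src d0) k2 by rewrite missing_kempe_swap d0C.
have fan'_e1 : e1 \in fan c' d0.
  rewrite inE; apply: connect_sub d0e1 => y z /andP[yz nz].
  exact/connect1/fan_step_kempe_swap.
have out_C e : e \in fan c' d0 -> tgt e \notin C -> ~~ missing c (tgt e) k.
  move=> fan'_e eC; have := fan_missing c'_max c'd0 fan'_e miss'_d0.
  by rewrite missing_kempe_swap (negPf eC) tpermR.
have [e1C|/(out_C e1 fan'_e1)] := boolP (tgt e1 \in C); last by rewrite miss_e1.
have fan'_e2 : e2 \in fan c' d0.
  apply: (subsetP (fan_kempe_swap d0C miss_d0 fan'_e1 _)) => //.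
  by rewrite missing_kempe_swap e1C.
by move: C12 (out_C e2 fan'_e2); rewrite e1C miss_e2 => /= e2C /(_ e2C).
Qed.

Definition fan_ends c d := [set tgt e | e in fan c d].

(* Every color missing at an end of the fan occurs at [src d], at a fan dart
   other than [d]; by [fan_missing_inj] it is missing at one end only. *)
Lemma sum_card_missing_fan c d k :
    maximal_coloring c -> c d = None -> missing c (src d) k ->
  \sum_(v in fan_ends c d) #|[set k' | missing c v k']| < #|fan c d|.
Proof.
move=> c_max cd miss_d.
have -> : \sum_(v in fan_ends c d) #|[set k' | missing c v k']|
    = #|[set q : vert G * K | (q.1 \in fan_ends c d) && missing c q.1 q.2]|.
  rewrite -sum1_card (eq_bigl _ _ (in_set _)).
  rewrite -(pair_big_dep _ _ (fun _ _ => 1)) /=.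
  by apply: eq_bigr => v _; rewrite sum1dep_card.
set M := [set _ | _].
have snd_inj : {in M &, injective (fun q : vert G * K => Some q.2)}.
  move=> [v1 k1] [v2 k2]; rewrite !inE /=.
  move=> /andP[/imsetP[e1 + ->] miss1] /andP[/imsetP[e2 + ->] miss2] [kE].
  rewrite -kE in miss2 * => fan1 fan2; congr (_, _).
  exact: fan_missing_inj c_max cd miss_d fan1 fan2 miss1 miss2.
suff sub : [set Some q.2 | q in M] \subset c @: (fan c d :\ d).
  rewrite -(card_in_imset snd_inj) (cardsD1 d (fan c d)) fan_id ltnS.
  exact: leq_trans (subset_leq_card sub) (leq_imset_card _ _).
apply/subsetP=> _ /imsetP[[v k'] + ->] /=; rewrite inE /=.
case/andP=> /imsetP[e fan_e ->] miss_e.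
have /missingPn[e' e'd ce'] : ~~ missing c (src d) k'.
  by apply: contraL miss_e => /(fan_missing c_max cd fan_e).
apply/imsetP; exists e' => //; rewrite in_setD1; apply/andP; split.
  by apply: contra_eq_neq cd => <-; rewrite ce'.
by apply: fan_step_fan fan_e _; apply/fan_stepP; exists k'.
Qed.

Section Bounds.

Variables max_deg max_mult : nat.
Hypothesis degree_le : forall v : vert G, degree v <= max_deg.
Hypothesis mult_le : forall u v : vert G,
  #|[set d : dart G | src d == u & tgt d == v]| <= max_mult.

Lemma card_missing_ge c v :
  max_deg + max_mult <= #|K| -> max_mult <= #|[set k | missing c v k]|.
Proof.
rewrite -(cardsC [set k | missing c v k]).
suff : #|~: [set k | missing c v k]| <= max_deg by lia.
apply: leq_trans (degree_le v); rewrite -(card_imset _ (@Some_inj _)).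
apply: leq_trans (leq_imset_card c _); apply/subset_leq_card/subsetP.
move=> _ /imsetP[k + ->]; rewrite !inE => /missingPn[d dv cd].
by apply/imsetP; exists d; rewrite ?inE ?dv.
Qed.

Lemma card_fan_le c d : #|fan c d| <= #|fan_ends c d| * max_mult.
Proof.
rewrite -sum1_card (partition_big_imset (fun e => tgt e)) /= -sum_nat_const.
apply: leq_sum => v _; rewrite sum1_card; apply: leq_trans (mult_le (src d) v).
apply/subset_leq_card/subsetP=> e; rewrite unfold_in /= => /andP[fan_e ev].
by rewrite inE ev (fan_src fan_e) eqxx.
Qed.

Lemma maximal_coloring_total c : maximal_coloring c ->
  max_deg + max_mult <= #|K| -> forall d, c d.
Proof.
move=> c_max K_large d; case cd: (c d) => [//|].
have mult_gt0 : 0 < max_mult.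
  apply: leq_trans (mult_le (src d) (tgt d)); rewrite card_gt0.
  by apply/set0Pn; exists d; rewrite inE !eqxx.
have missing_ge v := card_missing_ge c v K_large.
have [k] : exists k, k \in [set k | missing c (src d) k].
  by apply/set0Pn; rewrite -card_gt0; apply: leq_trans (missing_ge _).
rewrite inE => /(sum_card_missing_fan c_max cd); rewrite ltnNge => /negP[].
apply: leq_trans (card_fan_le c d) _; rewrite -sum_nat_const.
exact: leq_sum.
Qed.

End Bounds.

Lemma maximal_coloring_exists : exists c, maximal_coloring c.
Proof.
have empty_ok : partial_coloring [ffun=> None].
  by apply/partial_coloringP; split=> [d|d d' k _]; rewrite !ffunE.
have [c c_ok c_max] := arg_maxnP (fun c => #|colored c|) empty_ok.
by exists c.
Qed.

End PartialEdgeColorings.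

Theorem vizing_multigraph (G : multigraph) (K : finType)
    (max_deg max_mult : nat) :
    (forall v : vert G, degree v <= max_deg) ->
    (forall u v : vert G,
       #|[set d : dart G | src d == u & tgt d == v]| <= max_mult) ->
    max_deg + max_mult <= #|K| ->
  exists2 c : dart G -> K, forall d, c (drev d) = c d &
    forall d d', src d = src d' -> c d = c d' -> d = d'.
Proof.
move=> degree_le mult_le K_large; have [c c_max] := maximal_coloring_exists G K.
have c_total := maximal_coloring_total degree_le mult_le c_max K_large.
have /fin_all_exists[color colorE] d : exists k, c d = Some k.
  by case: (c d) (c_total d) => [k|//]; exists k.
have [cV c_inj] := partial_coloringP c c_max.1.
exists color => [d|d d' dd' cE]; first by apply: Some_inj; rewrite -!colorE.
by apply: c_inj dd' (colorE d) _; rewrite cE.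
Qed.

(** * The genus inequality *)

Section Porbits.

Variable T : finType.
Implicit Types (s p : {perm T}) (x y : T).

Lemma porbit_fconnect s f x y :
  s =1 f -> (y \in porbit s x) = fconnect f x y.
Proof.
move=> sf; have iterE i : (s ^+ i)%g x = iter i f x.
  by rewrite permX (eq_iter sf).
apply/porbitP/idP => [[i ->]|/iter_findex <-].
  by rewrite iterE fconnect_iter.
by exists (findex f x y); rewrite iterE.
Qed.

Lemma porbit_invariant (K : eqType) s (k : T -> K) x y :
  k \o s =1 k -> x \in porbit s y -> k x = k y.
Proof.
move=> ks; rewrite (porbit_fconnect _ _ (frefl s)).
by move/fconnect_invariant=> inv; apply/esym/inv => z; apply/eqP/ks.
Qed.

Lemma porbit_comp s : porbit s \o s =1 porbit s.
Proof.
by move=> z; apply/eqP; rewrite eq_porbit_mem; apply: (mem_porbit s 1).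
Qed.

Lemma card_porbits_fcard s f : s =1 f -> #|porbits s| = fcard f T.
Proof.
move=> sf; have f_inj : injective f by move=> x y; rewrite -!sf => /perm_inj.
have symf := fconnect_sym f_inj.
have rootE x y : (porbit s x == porbit s y) = (froot f x == froot f y).
  by rewrite eq_porbit_mem (porbit_fconnect _ _ sf) symf root_connect.
have -> : porbits s = porbit s @: froots f.
  apply/setP=> A; apply/imsetP/imsetP => -[x _ ->]; last by exists x.
  exists (froot f x); first exact: roots_root.
  by apply/eqP; rewrite rootE root_root.
rewrite card_in_imset => [|x y].
  by apply: eq_card => x; rewrite !inE andbT.
by move=> /eqP rx /eqP ry /eqP; rewrite rootE rx ry => /eqP.
Qed.

Lemma card_porbits_tperm_split s x y : x != y -> x \in porbit s y ->
  #|porbits (tperm x y * s)| = #|porbits s| + 1.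
Proof.
by move=> nxy xy; have := porbits_mul_tperm s x y; rewrite /= xy nxy addn0.
Qed.

Lemma card_porbits_tperm_merge s x y : x \notin porbit s y ->
  #|porbits (tperm x y * s)| + 1 = #|porbits s|.
Proof.
move=> xy; have nxy : x != y by apply: contraNneq xy => ->; apply: porbit_id.
by have := porbits_mul_tperm s x y; rewrite /= xy nxy; lia.
Qed.

Lemma card_porbits_tperm_le s x y :
  #|porbits (tperm x y * s)| <= #|porbits s| + 1.
Proof. by have := porbits_mul_tperm s x y => /=; case: (x != y); lia. Qed.

Lemma tperm_invariant (K : Type) (k : T -> K) x y :
  k x = k y -> k \o tperm x y =1 k.
Proof. by move=> kxy z /=; case: tpermP => // ->. Qed.

Lemma mem_porbit_tperm_merge s x y :
  x \notin porbit s y -> x \in porbit (tperm x y * s) y.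
Proof.
move/card_porbits_tperm_merge=> merge; apply/negPn/negP.
by move/card_porbits_tperm_merge; rewrite mulgA tperm2 mul1g; lia.
Qed.

Lemma sub_porbit_tperm_merge s x y u v :
    x \notin porbit s y -> u \in porbit s v ->
  u \in porbit (tperm x y * s) v.
Proof.
set s' := (tperm x y * s)%g => /mem_porbit_tperm_merge xy uv.
have t_inv : porbit s' \o tperm x y =1 porbit s'.
  by apply: tperm_invariant; apply/eqP; rewrite eq_porbit_mem.
rewrite -eq_porbit_mem; apply/eqP/(porbit_invariant _ uv) => z /=.
by rewrite -[RHS]t_inv -[RHS]porbit_comp /= permM tpermK.
Qed.

Lemma porbit_tperm_merge s x y u v :
    x \notin porbit s y -> u \in porbit s x -> v \in porbit s y ->
  u \in porbit (tperm x y * s) v.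
Proof.
move=> xy ux vy; have := mem_porbit_tperm_merge xy.
have := sub_porbit_tperm_merge xy vy; have := sub_porbit_tperm_merge xy ux.
by rewrite -!eq_porbit_mem => /eqP -> /eqP -> /eqP ->.
Qed.

Lemma card_porbits_le s : #|porbits s| <= #|T|.
Proof. exact: leq_imset_card. Qed.

Lemma identify_values (K : finType) (k : T -> K) x y : exists f : K -> K,
  f (k x) = f (k y) /\ #|k @: T| <= #|(f \o k) @: T| + 1.
Proof.
exists (fun a => if a == k y then k x else a).
split; first by rewrite eqxx if_same.
rewrite (cardsD1 (k y) (k @: T)) imset_f // add1n addn1 ltnS.
apply/subset_leq_card/subsetP=> a /setD1P[a_neq /imsetP[z _ aE]].
by apply/imsetP; exists z; rewrite //= -aE (negPf a_neq).
Qed.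

(* Writing [p] as a product of transpositions, each factor changes the numbers
   of orbits of [p] and [p * s] by one, and a factor that identifies two values
   of [k] merges two orbits of [p * s]. *)
Lemma genus_inequality p s : exists k : T -> {set T},
  [/\ k \o s =1 k, k \o p =1 k &
    #|porbits (p * s)| + #|porbits s| + #|porbits p| <= #|T| + 2 * #|k @: T|].
Proof.
have [n] := ubnP (#|T| - #|porbits p|); elim: n => // n IHn in p *.
rewrite ltnS => le_n; have [/forallP p_id|] := boolP [forall z, p z == z].
  exists (porbit s); have -> : p = 1%g.
    by apply/permP=> z; rewrite perm1 (eqP (p_id z)).
  split=> [z|z|]; [exact: porbit_comp | by rewrite /= perm1 | rewrite mul1g].
  by have := card_porbits_le 1; rewrite -[porbit s @: T]/(porbits s); lia.
rewrite negb_forall => /existsP[y]; set x := p y => nxy.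
pose p' := (tperm x y * p)%g.
have pE : p = (tperm x y * p')%g by rewrite mulgA tperm2 mul1g.
have card_p' : #|porbits p'| = #|porbits p| + 1.
  by apply: card_porbits_tperm_split => //; apply: (mem_porbit p 1).
have [|k [ks kp' le_k]] := IHn p'; first by have := card_porbits_le p'; lia.
have card_ps : #|porbits (p * s)| = #|porbits (tperm x y * (p' * s))|.
  by rewrite mulgA -pE.
have [kxy|nkxy] := eqVneq (k x) (k y).
  exists k; split=> // [z|].
    by rewrite pE /= permM -[LHS]/((k \o p') _) kp' -[RHS](tperm_invariant kxy).
  by have := card_porbits_tperm_le (p' * s) x y; rewrite -card_ps; lia.
have kp's : k \o (p' * s)%g =1 k.
  by move=> z; rewrite /= permM -[LHS]/((k \o s) _) ks -[RHS]kp'.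
have xy_out : x \notin porbit (p' * s) y.
  by apply: contra nkxy => /(porbit_invariant kp's) ->.
have [f [fxy le_f]] := identify_values k x y.
exists (f \o k); split=> [z|z|].
- by rewrite /= -[k (s z)]/((k \o s) z) ks.
- rewrite pE /= permM -[k (p' _)]/((k \o p') _) kp'.
  exact: (tperm_invariant (k := f \o k)).
by have := card_porbits_tperm_merge xy_out; rewrite -card_ps; lia.
Qed.

Lemma euler_excess_invariant p s :
    #|T| + 2 < #|porbits (p * s)| + #|porbits s| + #|porbits p| ->
  exists A : {set T}, [/\ A != set0, A != setT,
    forall z, (s z \in A) = (z \in A) & forall z, (p z \in A) = (z \in A)].
Proof.
have [k [ks kp le_k]] := genus_inequality p s => /leq_trans/(_ le_k) excess.
have /card_gt1P[_ [_ [/imsetP[x _ ->] /imsetP[y _ ->] nk]]] : 1 < #|k @: T|.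
  by lia.
exists [set z | k z == k x]; split=> [||z|z].
- by apply/set0Pn; exists x; rewrite inE.
- apply: contraNneq nk => A_full; have := in_setT y.
  by rewrite -A_full inE eq_sym.
- by rewrite !inE -[k (s z)]/((k \o s) z) ks.
- by rewrite !inE -[k (p z)]/((k \o p) z) kp.
Qed.

End Porbits.

(** * Edge connectivity *)

Section EdgeCuts.

Variable G : multigraph.
Implicit Types (A : {set vert G}) (X : {set dart G}) (d : dart G).

Definition edge_cut A : {set dart G} :=
  [set d | (src d \in A) && (tgt d \notin A)].

Definition edge_connected (k : nat) :=
  forall A, A != set0 -> A != setT -> k <= #|edge_cut A|.

Lemma edge_connected_leq j k : j <= k -> edge_connected k -> edge_connected j.
Proof. by move=> jk conn A A0 AT; apply: leq_trans jk (conn A A0 AT). Qed.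

Lemma leq_card_edge_cut A X :
    (forall d, d \in edge_cut A -> (d \in X) || (drev d \in X)) ->
  #|edge_cut A| <= #|X|.
Proof.
move=> cutX; pose f d := if d \in X then d else drev d.
have f_inj : {in edge_cut A &, injective f}.
  have no_rev d : d \in edge_cut A -> drev d \notin edge_cut A.
    by rewrite !inE drevK => /andP[-> _]; rewrite andbF.
  move=> d d' dA d'A; rewrite /f; case: ifP => _; case: ifP => _ // fE.
  - by have := no_rev _ d'A; rewrite -fE dA.
  - by have := no_rev _ dA; rewrite fE d'A.
  - exact: drev_inj fE.
rewrite -(card_in_imset f_inj); apply/subset_leq_card/subsetP.
by move=> _ /imsetP[d /cutX dX ->]; rewrite /f; case: ifP dX.
Qed.

Lemma card_edge_cut_complete A :
    (forall u v, u \in A -> v \notin A -> adj u v) ->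
  #|A| * #|~: A| <= #|edge_cut A|.
Proof.
move=> complete; rewrite -cardsX.
apply: leq_trans (leq_imset_card (fun d => (src d, tgt d)) _).
apply/subset_leq_card/subsetP=> -[u v]; rewrite !inE /= => /andP[uA vA].
have /existsP[d /andP[/eqP du /eqP dv]] := complete u v uA vA.
by apply/imsetP; exists d; rewrite ?inE du dv ?uA.
Qed.

(* If [a] in [A] and [b] outside are not adjacent, choosing in each edge of the
   cut an end other than [a] and [b] gives a separating set of vertices. *)
Lemma k_connected_edge_connected k : k_connected k G -> edge_connected k.
Proof.
case=> k_lt conn A A0 AT; have [/forallP complete|] :=
    boolP [forall u, forall v, (u \in A) ==> (v \notin A) ==> adj u v].
  have : #|A| * #|~: A| <= #|edge_cut A|.
    apply: card_edge_cut_complete => u v uA vA.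
    by have /forallP/(_ v) := complete u; rewrite uA vA.
  have := cardsC A; rewrite -card_gt0 in A0.
  have : 0 < #|~: A| by rewrite card_gt0 -setCT (inj_eq (@setC_inj _)).
  by nia.
rewrite negb_forall => /existsP[a]; rewrite negb_forall => /existsP[b].
rewrite 2!negb_imply => /and3P[aA bA nab]; rewrite leqNgt; apply/negP=> cut_lt.
pose S := [set if src d == a then tgt d else src d | d in edge_cut A].
have S_lt : #|S| < k by apply: leq_ltn_trans cut_lt; apply: leq_imset_card.
have aS : a \notin S.
  apply/imsetP=> -[d]; rewrite inE => /andP[_ dA] aE; move: aE dA.
  by case: eqP => [_ <-|/nesym//]; rewrite aA.
have bS : b \notin S.
  apply/imsetP=> -[d dA]; move: (dA); rewrite inE => /andP[sdA _].
  case: eqP => [da bE|_ bE]; last by rewrite bE sdA in bA.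
  by case/negP: nab; apply/existsP; exists d; rewrite da bE !eqxx.
have : b \in A; last by rewrite (negPf bA).
have ab := conn S S_lt a b aS bS.
suff : b \in [pred u | (u \in A) && (u \notin S)] by case/andP.
apply: (connect_stable _ ab) => [u v|]; last by rewrite inE aA aS.
case/andP=> /existsP[d /andP[/eqP <- /eqP <-]] vS; rewrite !inE vS andbT.
case/andP=> duA duS; apply: contraT => dvA.
have : (if src d == a then tgt d else src d) \in S by rewrite imset_f ?inE ?duA.
by case: eqP => _; rewrite ?(negPf vS) ?(negPf duS).
Qed.

End EdgeCuts.

Lemma plane_graph_has_dart (G : plane_graph) : 0 < #|dart G|.
Proof.
rewrite lt0n; apply/eqP=> /card0_eq dart0.
have vert1 : #|vert G| <= 1.
  apply/fintype_le1P=> u v; have /connectP[[|w p] /=] := plane_connected v u.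
    by [].
  by case/andP=> /existsP[d]; have := dart0 d.
have faces0 : fcard (fun d : dart G => drot (drev d)) (dart G) = 0.
  by apply: eq_card0 => d; have := dart0 d.
by have := euler_formula G; rewrite faces0 (eq_card0 dart0); lia.
Qed.

Lemma vertex_dart (G : plane_graph) (v : vert G) :
  exists d : dart G, src d == v.
Proof.
have /card_gt0P[d0 _] := plane_graph_has_dart G.
have [<-|nv] := eqVneq (src d0) v; first by exists d0.
have /connectP[[|w p] /=] := plane_connected v (src d0).
  by move=> _ dv; rewrite dv eqxx in nv.
by case/andP=> /existsP[d /andP[sd _]] _ _; exists d.
Qed.

Definition dart_at (G : plane_graph) (v : vert G) : dart G :=
  xchoose (vertex_dart v).

Lemma src_dart_at (G : plane_graph) (v : vert G) : src (dart_at v) = v.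
Proof. exact/eqP/(xchooseP (vertex_dart v)). Qed.

Section PlaneDuality.

Variable G : plane_graph.
Implicit Types (d : dart G).

Definition drot_perm : {perm dart G} := perm (@drot_inj G).
Definition drev_perm : {perm dart G} := perm (@drev_inj G).

Lemma src_drot d : src (drot d) = src d.
Proof. by apply/eqP; rewrite eq_sym -drot_orbit fconnect1. Qed.

Lemma face_next_inj : injective (@face_next G).
Proof. by move=> d d' /drot_inj/drev_inj. Qed.

Lemma src_face_next d : src (face_next d) = tgt d.
Proof. exact: src_drot. Qed.

Lemma face_permE : (drev_perm * drot_perm)%g =1 @face_next G.
Proof. by move=> d; rewrite permM !permE. Qed.

Definition face d : dart G := froot (@face_next G) d.

Lemma face_eq d d' : (face d == face d') = fconnect (@face_next G) d d'.
Proof. exact/root_connect/fconnect_sym/face_next_inj. Qed.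

Lemma face_id d : face (face d) = face d.
Proof. exact/root_root/fconnect_sym/face_next_inj. Qed.

Lemma face_face_next d : face (face_next d) = face d.
Proof. by apply/esym/eqP; rewrite face_eq fconnect1. Qed.

Lemma face_eq_porbit d d' :
  (face d == face d') = (d \in porbit (drev_perm * drot_perm) d').
Proof. by rewrite face_eq porbit_sym (porbit_fconnect _ _ face_permE). Qed.

Lemma face_vertsP d v :
  reflect (exists2 d', face d' = face d & src d' = v) (v \in face_verts d).
Proof.
apply: (iffP imsetP) => [[d' dd' ->]|[d' d'd <-]]; exists d' => //.
  by apply/esym/eqP; rewrite face_eq.
by rewrite -[_ \in _]/(fconnect _ d d') -face_eq d'd.
Qed.

Lemma card_porbits_drot : #|porbits drot_perm| = #|vert G|.
Proof.
have src_porbit d d' :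
    (porbit drot_perm d == porbit drot_perm d') = (src d == src d').
  by rewrite eq_porbit_mem (porbit_fconnect _ _ (permE _)) drot_orbit eq_sym.
have dart_at_inj : injective (fun v => porbit drot_perm (dart_at v)).
  by move=> u v /eqP; rewrite src_porbit !src_dart_at => /eqP.
rewrite -(card_imset _ dart_at_inj); apply: eq_card => A.
apply/imsetP/imsetP => -[x _ ->]; last by exists (dart_at x).
by exists (src x) => //; apply/eqP; rewrite src_porbit src_dart_at.
Qed.

Lemma card_porbits_drev : #|porbits drev_perm| * 2 = #|dart G|.
Proof.
rewrite (card_porbits_fcard (permE _)); apply: fcard_order_set => //.
  exact: drev_inj.
apply/subsetP=> d _; rewrite inE.
have drev_cycle : fcycle (@drev G) [:: d; drev d] by rewrite /= drevK !eqxx.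
by rewrite (order_cycle drev_cycle) ?mem_head //= inE eq_sym drev_neq.
Qed.

Definition euler_sum (p : {perm dart G}) : nat :=
  #|porbits (p * drot_perm)| + #|porbits drot_perm| + #|porbits p|.

Lemma euler_sum_drev : euler_sum drev_perm = #|dart G| + 2.
Proof.
have euler : #|vert G| + fcard (@face_next G) (dart G) = #|dart G|./2 + 2.
  exact: euler_formula.
rewrite /euler_sum (card_porbits_fcard face_permE) card_porbits_drot.
by have := card_porbits_drev; lia.
Qed.

Lemma euler_sum_le (k : nat) (X : {set dart G}) (p : {perm dart G}) :
    edge_connected G k -> #|X| < k ->
    (forall d, p d != drev d -> (d \in X) || (drev d \in X)) ->
  euler_sum p <= #|dart G| + 2.
Proof.
move=> conn X_lt pX; rewrite leqNgt; apply/negP=> /euler_excess_invariant.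
case=> B [B0 BT rotB pB]; pose A := [set v | dart_at v \in B].
have inA d : (src d \in A) = (d \in B).
  rewrite inE; apply: (@fconnect_invariant _ (@drot G) _ (fun e => e \in B)).
    by move=> e; have := rotB e; rewrite permE /= => ->; rewrite eqxx.
  by rewrite drot_orbit src_dart_at.
suff : #|edge_cut A| <= #|X|.
  move=> /leq_ltn_trans/(_ X_lt); rewrite ltnNge conn //.
    by have /set0Pn[d dB] := B0; apply/set0Pn; exists (src d); rewrite inA.
  apply: contraNneq BT => AT; apply/eqP/setP=> d; have := in_setT (src d).
  by rewrite -AT inA => ->; rewrite inE.
apply: leq_card_edge_cut => d; rewrite inE !inA => /andP[dB ndB]; apply: pX.
by apply: contraNneq ndB => <-; rewrite pB.
Qed.

(* Deleted edges become pairs of fixed points of the edge reversal; the faces of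
   the remaining graph are then orbits of [p * drot_perm]. *)
Definition delete_edge (p : {perm dart G}) d : {perm dart G} :=
  (tperm d (drev d) * p)%g.

Lemma card_porbits_delete_edge (p : {perm dart G}) d : p (drev d) = d ->
  #|porbits (delete_edge p d)| = #|porbits p| + 1.
Proof.
move=> pd; apply: card_porbits_tperm_split; first by rewrite eq_sym drev_neq.
by rewrite -{1}pd; apply: (mem_porbit p 1).
Qed.

Lemma euler_sum_delete_same (p : {perm dart G}) d :
    p (drev d) = d -> d \in porbit (p * drot_perm) (drev d) ->
  euler_sum (delete_edge p d) = euler_sum p + 2.
Proof.
move=> pd dd; rewrite /euler_sum card_porbits_delete_edge // -mulgA.
by rewrite (card_porbits_tperm_split _ dd) 1?eq_sym ?drev_neq //; lia.
Qed.

Lemma euler_sum_delete_diff (p : {perm dart G}) d :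
    p (drev d) = d -> d \notin porbit (p * drot_perm) (drev d) ->
  euler_sum (delete_edge p d) = euler_sum p.
Proof.
move=> pd dd; rewrite /euler_sum card_porbits_delete_edge //.
have <- : #|porbits (delete_edge p d * drot_perm)| + 1
    = #|porbits (p * drot_perm)|.
  by rewrite -mulgA; apply: card_porbits_tperm_merge.
by lia.
Qed.

Lemma dual_loopless d : edge_connected G 2 -> face (drev d) != face d.
Proof.
move=> conn; rewrite eq_sym face_eq_porbit; apply/negP=> dd.
suff : euler_sum (delete_edge drev_perm d) <= #|dart G| + 2.
  by rewrite euler_sum_delete_same ?permE ?drevK // euler_sum_drev; lia.
apply: (@euler_sum_le 2 [set d]); rewrite ?cards1 // => e.
apply: contraR; rewrite !inE negb_or drev_eq => /andP[ed erd].
by rewrite permM permE tpermD // eq_sym.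
Qed.

(* Deleting the first edge merges the two faces, so that the second one becomes
   a bridge. *)
Lemma dual_simple d1 d2 :
    edge_connected G 3 ->
    face d1 = face d2 -> face (drev d1) = face (drev d2) ->
  d1 = d2.
Proof.
move=> conn /esym/eqP d12 /esym/eqP rd12.
have loopless d := dual_loopless d (edge_connected_leq (leqnSn 2) conn).
have [//|n1] := eqVneq d1 d2.
have n2 : d2 != drev d1 by apply: contraTneq d12 => ->.
rewrite !face_eq_porbit in d12 rd12.
have d1_out : d1 \notin porbit (drev_perm * drot_perm) (drev d1).
  by rewrite -face_eq_porbit eq_sym.
pose p := delete_edge drev_perm d1.
have d2_bridge : d2 \in porbit (p * drot_perm) (drev d2).
  by rewrite -mulgA; apply: porbit_tperm_merge.
have pd2 : p (drev d2) = d2.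
  rewrite permM permE tpermD ?drevK //; first by rewrite eq_sym drev_eq.
  by rewrite (inj_eq (@drev_inj G)).
suff : euler_sum (delete_edge p d2) <= #|dart G| + 2.
  rewrite euler_sum_delete_same // euler_sum_delete_diff ?permE ?drevK //.
  by rewrite euler_sum_drev; lia.
apply: (@euler_sum_le 3 [set d1; d2]); rewrite ?cards2 ?n1 // => e.
apply: contraR; rewrite !inE !negb_or !drev_eq.
move=> /andP[/andP[e1 e2] /andP[re1 re2]].
by rewrite !permM permE !tpermD // eq_sym.
Qed.

Lemma face_degree_ge3 d :
  simple_graph G -> edge_connected G 2 -> 3 <= face_degree d.
Proof.
move=> simpleG conn; pose f := @face_next G.
have neq1 d' : src (f d') != src d' by rewrite src_face_next no_loop.
have neq2 : src (f (f d)) != src d.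
  apply: contraNneq (dual_loopless d conn) => eq2.
  have <- : f d = drev d.
    by apply: simpleG; rewrite ?src_face_next // drevK -src_face_next.
  by rewrite face_face_next.
have in_face i : src (iter i f d) \in face_verts d.
  by apply: imset_f; apply: fconnect_iter.
apply/card_geqP; exists [:: src d; src (f d); src (f (f d))]; split=> //.
  by rewrite /= !inE !negb_or !(eq_sym (src d)) neq1 neq2 eq_sym neq1.
move=> v; rewrite !inE => /or3P[] /eqP ->.
- exact: (in_face 0).
- exact: (in_face 1).
- exact: (in_face 2).
Qed.

End PlaneDuality.

(** * Subdivisions *)

(* [initial e] is the first of the darts into which [e] is subdivided, and
   [parent g] is the dart subdivided into [g] and possibly others. The last
   field excludes faces all of whose vertices are new. *)
Record subdivision_map (R G : plane_graph) := SubdivisionMap {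
  old : vert R -> vert G;
  parent : dart G -> dart R;
  initial : dart R -> dart G;
  old_inj : injective old;
  initialK : cancel initial parent;
  src_initial : forall e, src (initial e) = old (src e);
  initial_parent : forall g, src g \in codom old -> initial (parent g) = g;
  parent_drev : forall g, parent (drev g) = drev (parent g);
  drot_initial : forall e, drot (initial e) = initial (drot e);
  drotK_new : forall g, src g \notin codom old -> drot (drot g) = g;
  parent_drot_new :
    forall g, src g \notin codom old -> parent (drot g) = drev (parent g);
  face_has_initial : forall g, exists e, face (initial e) = face g
}.

Section SubdivisionMap.

Variables (R G : plane_graph) (m : subdivision_map R G).

Definition is_new : pred (vert G) := [pred v | v \notin codom (old m)].

Lemma face_next_parent g :
  face_next g = initial m (face_next (parent m g)) \/
  parent m (face_next g) = parent m g /\ is_new (src (face_next g)).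
Proof.
have [g_old|g_new] := boolP (src (drev g) \in codom (old m)).
  left; rewrite /face_next -{1}(initial_parent g_old).
  by rewrite parent_drev drot_initial.
right; rewrite /face_next /is_new /= src_drot; split=> //.
by rewrite parent_drot_new // parent_drev drevK.
Qed.

Lemma face_initial_next g : face (initial m (face_next (parent m g))) = face g.
Proof.
pose stays := [pred h | [&& face h == face g, parent m h == parent m g
                          & is_new (src h)]].
apply/eqP; apply: contraT => nface.
have stays_step h : face h = face g -> parent m h = parent m g ->
    face_next h \in stays.
  move=> hg ph; rewrite inE face_face_next hg eqxx /=.
  case: (face_next_parent h) => [hE|[-> ->]]; last by rewrite ph eqxx.
  by case/eqP: nface; rewrite -ph -hE face_face_next.
have [e eE] := face_has_initial m (face_next g).
have : initial m e \in stays.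
  have /eqP := esym eE; rewrite face_eq => ge.
  apply: (connect_stable _ ge) => [h _ /eqP <-|]; last exact: stays_step.
  by case/and3P=> /eqP hg /eqP ph _; apply: stays_step.
by case/and3P=> _ _; rewrite /is_new /= src_initial codom_f.
Qed.

Lemma face_initial e e' :
  face e = face e' -> face (initial m e) = face (initial m e').
Proof.
move/eqP; rewrite face_eq.
apply: (fconnect_invariant (k := fun e => face (initial m e))) => d /=.
by rewrite -[d in face_next d](initialK m) face_initial_next eqxx.
Qed.

Lemma face_initial_parent g : face (initial m (parent m g)) = face g.
Proof.
by rewrite -[RHS]face_initial_next; apply: face_initial; rewrite face_face_next.
Qed.

Lemma face_parent g g' :
  (face (parent m g) == face (parent m g')) = (face g == face g').
Proof.
apply/eqP/eqP => [/face_initial|/eqP]; first by rewrite !face_initial_parent.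
rewrite face_eq.
apply: (fconnect_invariant (k := fun g => face (parent m g))) => h /=.
case: (face_next_parent h) => [->|[-> _]]; last exact: eqxx.
by rewrite initialK face_face_next eqxx.
Qed.

Lemma new_dart_cases g g' :
  is_new (src g) -> src g' = src g -> g' = g \/ g' = drot g.
Proof.
move=> g_new /eqP; rewrite eq_sym -drot_orbit => /iter_findex <-.
elim: findex => [|i [IHi|IHi]]; first by left.
- by right; rewrite iterS IHi.
- by left; rewrite iterS IHi (drotK_new g_new).
Qed.

Lemma drot_new_neq g : is_new (src g) -> drot g != g.
Proof.
move=> g_new; apply: contraNneq (drev_neq (parent m g)) => gE.
by rewrite -parent_drot_new // gE.
Qed.

Lemma new_dart_inj g g' :
  is_new (src g) -> src g' = src g -> parent m g' = parent m g -> g' = g.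
Proof.
move=> g_new /(new_dart_cases g_new)[//|->]; rewrite parent_drot_new // => /eqP.
by rewrite (negPf (drev_neq _)).
Qed.

Lemma degree_new g : is_new (src g) -> degree (src g) = 2.
Proof.
move=> g_new; have <- : #|[set g; drot g]| = 2.
  by rewrite cards2 eq_sym drot_new_neq.
apply: eq_card => d; rewrite !inE.
apply/eqP/orP => [/(new_dart_cases g_new)[] ->|[] /eqP ->].
- by left.
- by right.
- by [].
- exact: src_drot.
Qed.

End SubdivisionMap.

Lemma subdivision_map_refl (R : plane_graph) : inhabited (subdivision_map R R).
Proof.
have all_old (v : vert R) : v \in codom id by apply: codom_f.
by split; exists id id id => // g; rewrite ?all_old //; exists g.
Qed.

Lemma subdivision_map_comp (R G H : plane_graph) :
  subdivision_map R G -> subdivision_map G H -> inhabited (subdivision_map R H).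
Proof.
move=> m n.
have oldP g : src g \in codom (old n \o old m) ->
    exists2 d, g = initial n d & src d \in codom (old m).
  case/codomP=> u /= gu; have gE : initial n (parent n g) = g.
    by apply: initial_parent; rewrite gu codom_f.
  exists (parent n g); rewrite ?gE //; apply/codomP; exists u.
  by apply: (old_inj (s := n)); rewrite -src_initial gE.
have newP g : src g \notin codom (old n \o old m) -> is_new n (src g) \/
    exists2 d, g = initial n d & is_new m (src d).
  have [g_old g_new|] := boolP (src g \in codom (old n)); last by left.
  right; exists (parent n g); rewrite ?initial_parent //; apply: contra g_new.
  case/codomP=> u gu; apply/codomP; exists u.
  by rewrite -[g in LHS](initial_parent g_old) src_initial gu.
split; exists (old n \o old m) (parent m \o parent n) (initial n \o initial m).
- exact: inj_comp (@old_inj _ _ n) (@old_inj _ _ m).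
- exact: can_comp (@initialK _ _ n) (@initialK _ _ m).
- by move=> e /=; rewrite !src_initial.
- by move=> g /oldP[d -> d_old] /=; rewrite initialK initial_parent.
- by move=> g /=; rewrite !parent_drev.
- by move=> e /=; rewrite !drot_initial.
- move=> g /newP[g_new|[d -> d_new]]; first exact: drotK_new g_new.
  by rewrite !drot_initial (drotK_new d_new).
- move=> g /newP[g_new|[d -> d_new]] /=.
    by rewrite (parent_drot_new g_new) parent_drev.
  by rewrite drot_initial !initialK (parent_drot_new d_new).
- move=> g; have [d <-] := face_has_initial n g.
  by have [e ed] := face_has_initial m d; exists e; apply: face_initial.
Qed.

Lemma subdivision_map_edge (G H : plane_graph) :
  subdivides_edge G H -> inhabited (subdivision_map G H).
Proof.
case=> e [fV [fD [/bij_inj fV_inj [gD fDK gDK] [srcl srcr] drevl [rotl rotr]]]].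
have dart_ind (P : dart H -> Prop) :
    (forall d, P (fD (inl d))) -> (forall b, P (fD (inr b))) -> forall g, P g.
  by move=> Pl Pr g; rewrite -(gDK g); case: (gD g).
pose sub_edge b := if b then e else drev e.
pose par g := match gD g with inl d => d | inr b => sub_edge b end.
have parl d : par (fD (inl d)) = d by rewrite /par fDK.
have parr b : par (fD (inr b)) = sub_edge b by rewrite /par fDK.
have drevr b : drev (fD (inr b)) = fD (inl (sub_edge (~~ b))).
  by rewrite -[RHS]drevK drevl; case: b; rewrite /= ?(negPf (drev_neq e)) eqxx.
have new_notin b : src (fD (inr b)) \in codom (fun v => fV (Some v)) = false.
  by rewrite srcr; apply/codomP=> -[v /fV_inj].
split; exists (fun v => fV (Some v)) par (fun d => fD (inl d)) => //.
- by move=> u v /fV_inj[].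
- by apply: dart_ind => [d|b]; rewrite ?parl ?new_notin.
- apply: dart_ind => [d|b]; last first.
    by rewrite drevr parl parr; case: b; rewrite /= ?drevK.
  by rewrite drevl parl; case: eqP => [->|_];
    [|case: eqP => [->|_]]; rewrite ?parr ?parl //= drevK.
- apply: dart_ind => [d|b _]; first by rewrite srcl codom_f.
  by rewrite !rotr negbK.
- apply: dart_ind => [d|b _]; first by rewrite srcl codom_f.
  by rewrite rotr !parr; case: b; rewrite /= ?drevK.
- apply: dart_ind => [d|b]; first by exists d.
  exists (drot (sub_edge (~~ b))); apply/esym/eqP.
  by rewrite face_eq -rotl -drevr -/(face_next _) fconnect1.
Qed.

Lemma subdivision_has_map (R G : plane_graph) :
  subdivision R G -> inhabited (subdivision_map R G).
Proof.
elim=> [|G' H _ [m] /subdivision_map_edge[n]].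
  exact: subdivision_map_refl.
exact: subdivision_map_comp m n.
Qed.

Lemma orbit_behead (T : finType) (f : T -> T) x :
  orbit f x = x :: behead (orbit f x).
Proof. by rewrite /orbit -orderSpred. Qed.

Lemma path_filter_stable (T : eqType) (r : rel T) (P : pred T) x s :
    (forall y z, z \in s -> r y z -> P z -> P y) -> path r x s ->
  if P x then path r x (filter P s) else filter P s == [::].
Proof.
elim: s x => [|z s IHs] x stable /=; first by case: ifP.
case/andP=> xz /IHs filter_s; have Pzx := stable x z (mem_head z s) xz.
have {}filter_s : if P z then path r z (filter P s) else filter P s == [::].
  by apply: filter_s => y w ws; apply: stable; rewrite inE ws orbT.
case: (boolP (P z)) filter_s => [Pz|_ /eqP ->]; last by case: ifP.
by rewrite Pzx //= xz.
Qed.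

Lemma leq_t_num (G : multigraph) (s : seq (vert G)) :
    uniq s -> sorted (@adj G) s -> {in s, forall v, degree v = 2} ->
  size s <= t_num G.
Proof.
move=> s_uniq s_sorted s_deg; have s_lt : size s < #|vert G|.+1.
  by rewrite ltnS -(card_uniqP s_uniq) max_card.
apply: (leq_bigmax_cond (Ordinal s_lt)); apply/existsP; exists (in_tuple s).
by rewrite s_uniq s_sorted; apply/allP=> v /s_deg /eqP.
Qed.

Section NewSegments.

Variables (R G : plane_graph) (m : subdivision_map R G).

Definition new_segment (e : dart R) : seq (dart G) :=
  [seq g <- behead (orbit (@face_next G) (initial m e)) | parent m g == e].

Lemma mem_new_segment e g :
  (g \in new_segment e) = is_new m (src g) && (parent m g == e).
Proof.
rewrite mem_filter [RHS]andbC; case: eqP => //= ge.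
have := orbit_uniq (@face_next G) (initial m e).
have : g \in orbit (@face_next G) (initial m e).
  by rewrite -fconnect_orbit -face_eq -ge face_initial_parent.
rewrite orbit_behead /= inE => g_orbit /andP[e_notin _].
apply/idP/idP => [g_in|g_new].
  by apply: contra e_notin => /initial_parent; rewrite ge => {1}->.
case/predU1P: g_orbit => // gE; move: g_new.
by rewrite gE /is_new /= src_initial codom_f.
Qed.

Lemma sorted_new_segment e : sorted (frel (@face_next G)) (new_segment e).
Proof.
set x := initial m e; have := orbit_uniq (@face_next G) x.
rewrite orbit_behead => /andP[x_notin _].
have orbit_path : fpath (@face_next G) x (behead (orbit (@face_next G) x)).
  by rewrite /orbit -orderSpred /=; apply: fpath_traject.
have parent_stable y z : z \in behead (orbit (@face_next G) x) ->
    frel (@face_next G) y z -> parent m z == e -> parent m y == e.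
  move=> z_in /eqP yz; rewrite -yz.
  case: (face_next_parent m y) => [yE|[-> _] //].
  rewrite yE initialK => /eqP eE; have zx : z = x by rewrite -yz yE eE.
  by case/negP: x_notin; rewrite -{1}zx.
have := path_filter_stable parent_stable orbit_path.
by rewrite initialK eqxx; apply: path_sorted.
Qed.

Lemma uniq_new_segment e : uniq (map (@src G) (new_segment e)).
Proof.
rewrite map_inj_in_uniq => [|g g']; last first.
  rewrite !mem_new_segment => /andP[g_new /eqP ge] /andP[g'_new /eqP g'e] gg'.
  by apply: (new_dart_inj g'_new gg'); rewrite ge g'e.
rewrite filter_uniq //; have := orbit_uniq (@face_next G) (initial m e).
by rewrite orbit_behead => /andP[].
Qed.

Lemma card_new_darts_le e :
  #|[set g | is_new m (src g) & parent m g == e]| <= t_num G.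
Proof.
have <- : size (map (@src G) (new_segment e))
    = #|[set g | is_new m (src g) & parent m g == e]|.
  rewrite size_map -(card_uniqP (map_uniq (uniq_new_segment e))).
  by apply: eq_card => g; rewrite mem_new_segment !inE.
apply: leq_t_num; first exact: uniq_new_segment.
  rewrite sorted_map; apply: sub_sorted (sorted_new_segment e) => g _ /eqP <-.
  by apply/existsP; exists g; rewrite src_face_next !eqxx.
move=> _ /mapP[g + ->]; rewrite mem_new_segment => /andP[g_new _].
exact: degree_new g_new.
Qed.

End NewSegments.

(** * Cyclic colorings of subdivisions *)

Lemma chi_c_leq_card (G : plane_graph) (K : finType) (c : vert G -> K) :
  (forall d, {in face_verts d &, injective c}) -> chi_c G <= #|K|.
Proof.
move=> c_inj; rewrite /chi_c; case: ex_minnP => n _; apply.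
apply/existsP; exists [ffun v => enum_rank (c v)].
apply/forallP=> d; apply/forall_inP=> u ud; apply/forall_inP=> v vd.
apply/implyP; apply: contraNneq; rewrite !ffunE => /enum_rank_inj cE.
exact/eqP/(c_inj d).
Qed.

Lemma chi_c_coloring (G : plane_graph) :
  exists c : vert G -> 'I_(chi_c G), forall d, {in face_verts d &, injective c}.
Proof.
rewrite /chi_c; case: ex_minnP => n /existsP[c /forallP c_ok] _.
exists c => d u v ud vd cE; apply/eqP.
have /forall_inP/(_ u ud)/forall_inP/(_ v vd) := c_ok d.
by rewrite cE eqxx; case: eqP.
Qed.

Section NewDarts.

Variables (R G : plane_graph) (m : subdivision_map R G).

Lemma old_face_verts u d :
  (old m u \in face_verts d) = (u \in face_verts (parent m d)).
Proof.
apply/face_vertsP/face_vertsP => -[g gd gu].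
  have gE : initial m (parent m g) = g.
    by apply: initial_parent; rewrite gu codom_f.
  exists (parent m g); first by apply/eqP; rewrite face_parent gd.
  by apply: (old_inj (s := m)); rewrite -src_initial gE.
exists (initial m g); last by rewrite src_initial gu.
by apply/eqP; rewrite -(face_parent m) initialK gd.
Qed.

Hypothesis R2 : edge_connected R 2.

Lemma face_drot_new g : is_new m (src g) -> face (drot g) != face g.
Proof.
by move=> g_new; rewrite -(face_parent m) (parent_drot_new g_new) dual_loopless.
Qed.

Lemma new_face_src_inj g g' :
  is_new m (src g) -> face g' = face g -> src g' = src g -> g' = g.
Proof.
move=> g_new fE sE; have [//|g'E] := new_dart_cases g_new sE.
by have := face_drot_new g_new; rewrite -g'E fE eqxx.
Qed.

Definition new_face_darts d : {set dart G} :=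
  [set g | is_new m (src g) & face g == face d].

Lemma face_degree_parent d :
  face_degree d = face_degree (parent m d) + #|new_face_darts d|.
Proof.
set N := new_face_darts d; rewrite /face_degree.
have -> : face_verts d = (old m @: face_verts (parent m d)) :|: (@src G @: N).
  apply/setP=> v; rewrite inE; apply/idP/orP => [vd|[/imsetP[u ud ->]|]].
  - have [/codomP[u vu]|v_new] := boolP (v \in codom (old m)).
      by left; rewrite vu imset_f // -old_face_verts -vu.
    have /face_vertsP[g gd gv] := vd; right; rewrite -gv; apply: imset_f.
    by rewrite inE gd eqxx gv andbT.
  - by rewrite old_face_verts.
  - case/imsetP=> g; rewrite inE => /andP[_ /eqP gd] ->.
    by apply/face_vertsP; exists g.
have N_inj : {in N &, injective (@src G)}.
  move=> g g'; rewrite !inE => /andP[_ /eqP gd] /andP[g'_new /eqP g'd].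
  by apply: new_face_src_inj => //; rewrite gd g'd.
rewrite cardsU (card_imset _ (old_inj (s := m))) (card_in_imset N_inj).
suff -> : (old m @: face_verts (parent m d)) :&: (@src G @: N) = set0.
  by rewrite cards0 subn0.
apply/setP=> v; rewrite inE in_set0; apply/andP=> -[/imsetP[u _ ->] /imsetP[g]].
by rewrite inE => /andP[+ _] uE; rewrite /is_new /= -uE codom_f.
Qed.

Local Notation new_dart := {g : dart G | is_new m (src g)}.

Lemma is_new_drot (g : new_dart) : is_new m (src (drot (val g))).
Proof. by rewrite src_drot; apply: (valP g). Qed.

Definition drot_new (g : new_dart) : new_dart :=
  Sub (drot (val g)) (is_new_drot g).

Lemma drot_newK : involutive drot_new.
Proof. by move=> g; apply: val_inj; rewrite /= (drotK_new (valP g)). Qed.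

Lemma drot_new_loopless (g : new_dart) :
  face (val (drot_new g)) != face (val g).
Proof. exact: face_drot_new (valP g). Qed.

(* Every new vertex becomes an edge between its two faces. A face is represented
   by the value of [face] on its darts; any other dart is an isolated vertex. *)
Definition new_vertex_graph : multigraph :=
  Multigraph drot_newK drot_new_loopless.

End NewDarts.

Section NewVertexGraph.

Variables (R G : plane_graph) (m : subdivision_map R G).
Hypotheses (R_simple : simple_graph R) (R3 : edge_connected R 3).

Let R2 : edge_connected R 2 := edge_connected_leq (leqnSn 2) R3.
Local Notation H := (new_vertex_graph m R2).

Lemma face_degree_ge_new d :
  #|new_face_darts m d| + 3 <= max_face_degree G.
Proof.
apply: leq_trans (leq_bigmax d); rewrite (face_degree_parent m R2).
by rewrite addnC leq_add2r face_degree_ge3.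
Qed.

Lemma max_face_degree_ge3 : 3 <= max_face_degree G.
Proof.
have /card_gt0P[d _] := plane_graph_has_dart G.
exact: leq_trans (leq_addl _ _) (face_degree_ge_new d).
Qed.

Lemma degree_new_vertex_graph (f : vert H) : degree f + 3 <= max_face_degree G.
Proof.
apply: leq_trans (face_degree_ge_new f); rewrite leq_add2r.
rewrite /degree -(card_imset _ val_inj).
apply/subset_leq_card/subsetP=> _ /imsetP[g + ->].
by rewrite !inE => /eqP <-; rewrite face_id eqxx andbT; apply: (valP g).
Qed.

Lemma multiplicity_new_vertex_graph (f f' : vert H) :
  #|[set g : dart H | src g == f & src (drev g) == f']| <= t_num G.
Proof.
set N := [set g | _ & _].
have [->|[g0 g0N]] := set_0Vmem N; first by rewrite cards0.
have faces (g : dart H) :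
    g \in N -> face (val g) = f /\ face (drot (val g)) = f'.
  by rewrite inE => /andP[/eqP gf /eqP gf'].
apply: leq_trans (card_new_darts_le m (parent m (val g0))).
rewrite -(card_imset _ val_inj).
apply/subset_leq_card/subsetP=> _ /imsetP[g gN ->].
have [[g0f g0f'] [gf gf']] := (faces g0 g0N, faces g gN).
rewrite inE (valP g); apply/eqP/dual_simple => //; apply/eqP.
  by rewrite face_parent gf g0f.
rewrite -(parent_drot_new (valP g)) -(parent_drot_new (valP g0)).
by rewrite face_parent gf' g0f'.
Qed.

Lemma new_vertex_graph_coloring (K : finType) :
    max_face_degree G + t_num G <= #|K| + 3 ->
  exists2 c : dart H -> K, forall g, c (drev g) = c g &
    forall g g', src g = src g' -> c g = c g' -> g = g'.
Proof.
move=> K_large.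
apply: (@vizing_multigraph H K (max_face_degree G - 3) (t_num G)).
- by move=> f; have := degree_new_vertex_graph f; lia.
- exact: multiplicity_new_vertex_graph.
- by have := max_face_degree_ge3; lia.
Qed.

Section ExtendColoring.

Variables (K K' : finType) (c : vert R -> K) (c' : dart H -> K').
Hypothesis c_inj : forall d, {in face_verts d &, injective c}.
Hypothesis c'_drev : forall g, c' (drev g) = c' g.
Hypothesis c'_inj : forall g g', src g = src g' -> c' g = c' g' -> g = g'.

Definition dart_color (g : dart G) : K + K' :=
  if insub g is Some g' then inr (c' g') else inl (c (src (parent m g))).

Lemma dart_color_new (g : dart H) : dart_color (val g) = inr (c' g).
Proof. by rewrite /dart_color valK. Qed.

Lemma dart_color_old g : src g \in codom (old m) ->
  dart_color g = inl (c (src (parent m g))).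
Proof. by move=> g_old; rewrite /dart_color insubN //= negbK. Qed.

Lemma old_src_parent g :
  src g \in codom (old m) -> old m (src (parent m g)) = src g.
Proof. by move=> g_old; rewrite -src_initial initial_parent. Qed.

Lemma dart_color_src g g' : src g = src g' -> dart_color g = dart_color g'.
Proof.
move=> gg'; have [g_old|g_new] := boolP (src g \in codom (old m)).
  rewrite !dart_color_old -?gg' //; congr (inl (c _)).
  by apply: (old_inj (s := m)); rewrite !old_src_parent -?gg'.
pose h : dart H := exist _ g g_new.
have [->//|->] := new_dart_cases g_new (esym gg').
by rewrite (dart_color_new h) (dart_color_new (drev h)) c'_drev.
Qed.

Lemma dart_color_face_inj g g' :
  face g = face g' -> dart_color g = dart_color g' -> src g = src g'.
Proof.
move=> fE; have [g_old|g_new] := boolP (src g \in codom (old m));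
  have [g'_old|g'_new] := boolP (src g' \in codom (old m)).
- rewrite !dart_color_old // => -[cE].
  rewrite -(old_src_parent g_old) -(old_src_parent g'_old); congr (old m _).
  apply: (c_inj (d := parent m g)) cE;
    rewrite -old_face_verts old_src_parent //.
    by apply/face_vertsP; exists g.
  by apply/face_vertsP; exists g'.
- by rewrite dart_color_old // (dart_color_new (exist _ g' g'_new : dart H)).
- by rewrite [RHS]dart_color_old // (dart_color_new (exist _ g g_new : dart H)).
pose h : dart H := exist _ g g_new; pose h' : dart H := exist _ g' g'_new.
rewrite (dart_color_new h) (dart_color_new h') => -[cE].
by have /(congr1 val) /= -> := @c'_inj h h' fE cE.
Qed.

Lemma chi_c_le_sum : chi_c G <= #|K| + #|K'|.
Proof.
pose color v := dart_color (dart_at v).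
rewrite -card_sum; apply: (@chi_c_leq_card _ _ color).
move=> d u v /face_vertsP[g gd <-] /face_vertsP[g' g'd <-].
rewrite /color !(dart_color_src (src_dart_at _)).
by apply: dart_color_face_inj; rewrite gd.
Qed.

End ExtendColoring.

Lemma chi_c_subdivision_le :
  chi_c G + 3 <= chi_c R + max_face_degree G + t_num G.
Proof.
have face3 := max_face_degree_ge3.
pose K := 'I_(max_face_degree G + t_num G - 3).
have [c c_inj] := chi_c_coloring R.
have [|c' c'_drev c'_inj] := @new_vertex_graph_coloring K.
  by rewrite card_ord; lia.
by have := chi_c_le_sum c_inj c'_drev c'_inj; rewrite !card_ord; lia.
Qed.

End NewVertexGraph.

Theorem corollary3 (R G : plane_graph)
    (R_simple : simple_graph R) (R_3connected : k_connected 3 R)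
    (G_subdivision : subdivision R G)
    (large_face : 2 * chi_c R + 2 * t_num G <= max_face_degree G + 6) :
  chi_c G <= (3 * max_face_degree G) %/ 2.
Proof.
have [m] := subdivision_has_map G_subdivision.
have R3 := k_connected_edge_connected R_3connected.
have := chi_c_subdivision_le m R_simple R3.
by rewrite leq_divRL //; lia.
Qed.
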